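(* Under the barrier function hypothesis on $\omega\subseteq\partial\Omega$ stated in the context, $\overline v(t,x)=\underline v(t,x)=g(x)$ for all $(t,x)\in[0,T]\times\omega$.
   Context: **Problem data.** Let $d\ge 2$, $\Omega\subset\mathbb R^d$ a bounded Lipschitz domain, $T>0$, and $A,B$ compact metric spaces. For $(\alpha,\beta)\in A\times B$ let $a^{(\alpha,\beta)},c^{(\alpha,\beta)},f^{(\alpha,\beta)}\in C(\overline\Omega)$, $b^{(\alpha,\beta)}\in C(\overline\Omega,\mathbb R^d)$, $a^{(\alpha,\beta)}\ge 0$, with $(\alpha,\beta)\mapsto(a^{(\alpha,\beta)},b^{(\alpha,\beta)},c^{(\alpha,\beta)},f^{(\alpha,\beta)})$ continuous in the sup norms, the four families being equicontinuous. Let $v_T\in C(\overline\Omega)$, $g\in\{w\in W^{1,\infty}(\mathbb R^d):\Delta w\in L^\infty(\Omega)\}$, $v_T=g$ on $\partial\Omega$. **Finite elements.** For $i\in\mathbb N$ let $V_i$ be the space of continuous piecewise linear finite element functions on a mesh of $\Omega$ (the sequence being shape-regular) with nodes $y_i^\ell$ and hat functions $\phi_i^\ell$; $\hat\phi_i^\ell=\phi_i^\ell/\|\phi_i^\ell\|_{L^1(\Omega)}$. $V_i^0\subset V_i$ is the subspace vanishing on $\partial\Omega$, $N_i=\dim V_i^0$, and nodes are ordered so that $y_i^\ell\in\Omega$ iff $\ell\le N_i$. The mesh size $\Delta x_i\to0$; the uniform time step $h_i\to0$ with $T/h_i\in\mathbb N$; $s_i^k=kh_i$, $S_i=\{s_i^k:k=0,\dots,T/h_i\}$.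 Functions in $V_i$ are identified with their vectors of nodal values. $\langle\cdot,\cdot\rangle$ is the $L^2(\Omega)$ inner product. **Projections.** $P_i$ are linear mappings taking $H^1(\Omega)$ functions $w$ (time-dependent functions being projected at each time) into $V_i$ such that $\langle\nabla P_iw,\nabla\hat\phi_i^\ell\rangle=\langle\nabla w,\nabla\hat\phi_i^\ell\rangle$ for all $\hat\phi_i^\ell\in V_i^0$. It is assumed that there is $C\ge 0$ such that for every $w\in C^\infty(\mathbb R^d)$ and $i\in\mathbb N$: $\|P_iw\|_{W^{1,\infty}(\Omega)}\le C\|w\|_{W^{1,\infty}(\Omega)}$ and $\lim_{i\to\infty}\|P_iw-w\|_{W^{1,\infty}(\Omega)}=0$. $V_i^g\subset V_i$ is the set of functions which attain $P_ig$ on $\partial\Omega$. **Splitting.** Coefficients $\bar a_i^{(\alpha,\beta)},\bar{\bar a}_i^{(\alpha,\beta)}$ (scalar, with values at the nodes), $\bar b_i^{(\alpha,\beta)},\bar{\bar b}_i^{(\alpha,\beta)}$ ($\mathbb R^d$-valued), $\bar c_i^{(\alpha,\beta)},\bar{\bar c}_i^{(\alpha,\beta)},f_i^{(\alpha,\beta)}$ (scalar) depend continuously in $L^\infty$ on $(\alpha,\beta)\in A\times B$ for each $i$, and $$\lim_{i\to\infty}\sup_{(\alpha,\beta)}\Bigl(\sup_{1\le\ell\le N_i}\|a^{(\alpha,\beta)}-(\bar a_i^{(\alpha,\beta)}(y_i^\ell)+\bar{\bar a}_i^{(\alpha,\beta)}(y_i^\ell))\|_{L^\infty(\mathrm{supp}\,\hat\phi_i^\ell)}+\|b^{(\alpha,\beta)}-(\bar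 b_i^{(\alpha,\beta)}+\bar{\bar b}_i^{(\alpha,\beta)})\|_{L^\infty(\Omega,\mathbb R^d)}+\|c^{(\alpha,\beta)}-(\bar c_i^{(\alpha,\beta)}+\bar{\bar c}_i^{(\alpha,\beta)})\|_{L^\infty(\Omega)}+\|f^{(\alpha,\beta)}-f_i^{(\alpha,\beta)}\|_{L^\infty(\Omega)}\Bigr)=0.$$ Also $\bar c_i^{(\alpha,\beta)},\bar{\bar c}_i^{(\alpha,\beta)}\ge0$ and $\|\bar c_i^{(\alpha,\beta)}\|_{L^\infty}+\|\bar{\bar c}_i^{(\alpha,\beta)}\|_{L^\infty}\le\gamma$ for a constant $\gamma$ independent of $i,\alpha,\beta$. **Discrete operators.** For $\ell\le N_i$: $(\mathsf E_i^{(\alpha,\beta)}w)_\ell=\bar a_i^{(\alpha,\beta)}(y_i^\ell)\langle\nabla w,\nabla\hat\phi_i^\ell\rangle+\langle-\bar b_i^{(\alpha,\beta)}\cdot\nabla w+\bar c_i^{(\alpha,\beta)}w,\hat\phi_i^\ell\rangle$, $(\mathsf I_i^{(\alpha,\beta)}w)_\ell=\bar{\bar a}_i^{(\alpha,\beta)}(y_i^\ell)\langle\nabla w,\nabla\hat\phi_i^\ell\rangle+\langle-\bar{\bar b}_i^{(\alpha,\beta)}\cdot\nabla w+\bar{\bar c}_i^{(\alpha,\beta)}w,\hat\phi_i^\ell\rangle$, $(\mathsf F_i^{(\alpha,\beta)})_\ell=\langle f_i^{(\alpha,\beta)},\hat\phi_i^\ell\rangle$. For $\ell>N_i$: $(\mathsf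 E_i^{(\alpha,\beta)}w)_\ell=0$, $(\mathsf I_i^{(\alpha,\beta)}w)_\ell=w(y_i^\ell)$, $(\mathsf F_i^{(\alpha,\beta)})_\ell=(P_ig)_\ell$. **Monotonicity assumption.** For all $(\alpha,\beta)$ and $i$: $\mathsf E_i^{(\alpha,\beta)}$ restricted to $V_i$ (matrix in the nodal basis) has non-positive off-diagonal entries; $h_i$ is so small that all entries of $h_i\mathsf E_i^{(\alpha,\beta)}-\mathsf{Id}$ are non-positive; and $\mathsf I_i^{(\alpha,\beta)}$ has the local monotonicity property: if $v\in V_i$ has a non-positive local minimum at an interior node $y_i^\ell$ then $(\mathsf I_i^{(\alpha,\beta)}v)_\ell\le0$. **Scheme.** The numerical solution $v_i$ is given by $v_i(T,\cdot)=P_iv_T$ and, for $k=T/h_i-1,\dots,0$, by $v_i(s_i^k,\cdot)\in V_i^g$ solving $$-d_iv_i(s_i^k,\cdot)+\inf_{\beta\in B}\sup_{\alpha\in A}\bigl(\mathsf E_i^{(\alpha,\beta)}v_i(s_i^{k+1},\cdot)+\mathsf I_i^{(\alpha,\beta)}v_i(s_i^k,\cdot)-\mathsf F_i^{(\alpha,\beta)}\bigr)=0,$$ with inf and sup componentwise and $(d_iw(s_i^k,\cdot))_\ell=(w(s_i^{k+1},y_i^\ell)-w(s_i^k,y_i^\ell))/h_i$. **Envelopes.** $\overline v(t,x)=\limsup_{i\to\infty}\sup_{(s_i^k,y_i^\ell)\to(t,x)}v_i(s_i^k,y_i^\ell)$ and $\underline v(t,x)=\liminf_{i\to\infty}\inf_{(s_i^k,y_i^\ell)\to(t,x)}v_i(s_i^k,y_i^\ell)$,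 i.e. the largest (smallest) limit values along time steps and nodes converging to $(t,x)\in[0,T]\times\overline\Omega$ as $i\to\infty$. **Barrier function hypothesis.** For all $y\in\omega$, $\epsilon>0$ there are $\zeta_{y,\epsilon},\xi_{y,\epsilon}\in W^{1,\infty}([0,T]\times\overline\Omega)$ such that: (1a) there is $\hat i=\hat i(\epsilon)\in\mathbb N$ such that for all $i\ge\hat i$, $s_i^k\in S_i$, there is a minimiser of $v_i-P_i\zeta_{y,\epsilon}$ over $\{s_i^k\}\times\overline\Omega$ which lies on $\{s_i^k\}\times\partial\Omega$; (1b) for $t\in[0,T]$, with $q_{t,y,\epsilon}$ a minimiser of $g-\zeta_{y,\epsilon}$ over $\{t\}\times\partial\Omega$, $\lim_{\epsilon\to0}q_{t,y,\epsilon}=y$ and $\lim_{\epsilon\to0}(\zeta_{y,\epsilon}(t,y)-\zeta_{y,\epsilon}(t,q_{t,y,\epsilon}))\ge0$; (2a) there is $\hat i=\hat i(\epsilon)\in\mathbb N$ such that for all $i\ge\hat i$, $s_i^k\in S_i$, there is a maximiser of $v_i-P_i\xi_{y,\epsilon}$ over $\{s_i^k\}\times\overline\Omega$ which lies on $\{s_i^k\}\times\partial\Omega$; (2b) for $t\in[0,T]$, with $r_{t,y,\epsilon}$ a maximiser of $g-\xi_{y,\epsilon}$ over $\{t\}\times\partial\Omega$, $\lim_{\epsilon\to0}r_{t,y,\epsilon}=y$ and $\lim_{\epsilon\to0}(\xi_{y,\epsilon}(t,y)-\xi_{y,\epsilon}(t,r_{t,y,\epsilon}))\le0$.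
   Formalization: Added assumption: P_i g, P_i ζ_{y,ε} and P_i ξ_{y,ε} converge to g, ζ_{y,ε}, ξ_{y,ε} uniformly over time steps and the closure of Ω; approximation by P_i for smooth functions only does not give this, and the claim fails without it. *)

(* Defs.v *)
From HB Require Import structures.
From mathcomp Require Import all_boot all_order all_algebra.
From mathcomp Require Import all_classical all_reals all_analysis.
Set Implicit Arguments. Unset Strict Implicit. Unset Printing Implicit Defensive.
Import Order.TTheory GRing.Theory Num.Theory.
Import numFieldNormedType.Exports.
Local Open Scope classical_set_scope.
Local Open Scope ring_scope.

Section row_measurable.
Context {R : realType} {n : nat}.

Definition row_tuple (x : 'rV[R]_n) : n.-tuple (measurableTypeR R) :=
  [tuple x ord0 i | i < n].

HB.instance Definition _ :=
  Measurable.copy 'rV[R]_n (g_sigma_algebra_preimageType row_tuple).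

Lemma measurable_row_tuple : measurable_fun [set: 'rV[R]_n] row_tuple.
Proof. by move=> _ Y mY; rewrite setTI; exists Y; rewrite ?setTI. Qed.

Lemma measurable_fun_row d (X : measurableType d) (f : X -> 'rV[R]_n) :
  measurable_fun setT (row_tuple \o f) -> measurable_fun setT f.
Proof.
move=> mf _ _ [Y mY <-]; rewrite !setTI -comp_preimage.
by rewrite -[X in measurable X]setTI; exact: mf.
Qed.
End row_measurable.

Section row_cons.
Context {R : realType} {n : nat}.
Definition row_cons (p : measurableTypeR R * 'rV[R]_n) : 'rV[R]_n.+1 :=
  row_mx (const_mx p.1 : 'rV_1) p.2.
Definition row_uncons (x : 'rV[R]_n.+1) : measurableTypeR R * 'rV[R]_n :=
  (x ord0 ord0, rsubmx (x : 'rV_(1 + n))).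

Lemma row_consK : cancel row_cons row_uncons.
Proof.
move=> [r x]; rewrite /row_uncons /row_cons row_mxKr; congr pair.
transitivity (row_mx (const_mx r : 'rV_1) x ord0 (lshift n ord0)).
  by congr (row_mx _ _ _ _); exact/val_inj.
by rewrite row_mxEl mxE.
Qed.

Lemma row_cons_ord0 p : row_cons p ord0 ord0 = p.1.
Proof. by have := row_consK p; case: p => r x [+ _]. Qed.

Lemma measurable_row_cons : measurable_fun setT row_cons.
Proof.
apply: measurable_fun_row.
rewrite (_ : _ \o _ = fun p => [the n.+1.-tuple _ of p.1 :: row_tuple p.2]).
  apply: measurable_cons => //.
  by apply: measurableT_comp => //; exact: measurable_row_tuple.
apply/funext => p; apply: eq_from_tnth => i /=.
rewrite tnth_mktuple; have [j ->|->] := unliftP ord0 i.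
  rewrite tnthS tnth_mktuple /row_cons.
  transitivity (row_mx (const_mx p.1 : 'rV_1) p.2 ord0 (rshift 1 j)).
    by congr (row_mx _ _ _ _); exact/val_inj.
  by rewrite row_mxEr.
by rewrite row_cons_ord0.
Qed.

Lemma measurable_row_uncons : measurable_fun setT row_uncons.
Proof.
have mcoor (i : 'I_n.+1) :
    measurable_fun setT (fun x : 'rV[R]_n.+1 => x ord0 i : measurableTypeR R).
  rewrite (_ : (fun _ => _) = (@tnth _ (measurableTypeR R) ^~ i) \o row_tuple).
    apply: measurableT_comp; first exact: measurable_tnth.
    exact: measurable_row_tuple.
  by apply/funext => x /=; rewrite tnth_mktuple.
apply/measurable_fun_pairP; split; first exact: mcoor.
apply/measurable_fun_row/measurable_fun_tnthP => i.
rewrite (_ : _ \o _ = fun x : 'rV[R]_n.+1 => x ord0 (rshift 1 i)).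
  exact: mcoor.
by apply/funext => x /=; rewrite tnth_mktuple mxE.
Qed.

Context (mu : {sigma_finite_measure set 'rV[R]_n -> \bar R}).

Definition lebesgue_cons : set 'rV[R]_n.+1 -> \bar R :=
  pushforward (lebesgue_measure \x mu)%E row_cons.

HB.instance Definition _ := Measure.copy lebesgue_cons
  (measure_function_pushforward__canonical__measure_function_Measure
     (lebesgue_measure \x mu)%E measurable_row_cons).

Lemma lebesgue_cons_sigma_finite : sigma_finite setT lebesgue_cons.
Proof.
have /sigma_finiteP[F [FT ndF Foo]] := sigma_finiteT (@lebesgue_measure R).
have /sigma_finiteP[G [GT ndG Goo]] := sigma_finiteT mu.
exists (fun k => row_uncons @^-1` (F k `*` G k)).
  rewrite -preimage_bigcup; apply/esym/seteqP; split=> // x _ /=.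
  have [[i _ Fi] [j _ Gj]] : (\bigcup_k F k) (row_uncons x).1 /\
      (\bigcup_k G k) (row_uncons x).2 by rewrite -FT -GT.
  exists (maxn i j) => //; split.
  - by move: Fi; exact/subsetPset/ndF/leq_maxl.
  - by move: Gj; exact/subsetPset/ndG/leq_maxr.
move=> k; have [[mF Fk] [mG Gk]] := (Foo k, Goo k); split.
  rewrite -[_ @^-1` _]setTI; apply: measurable_row_uncons => //.
  exact: measurableX.
rewrite /lebesgue_cons /pushforward -comp_preimage.
rewrite (_ : row_uncons \o row_cons = id); last first.
  by apply/funext => x; exact: row_consK.
by rewrite product_measure1E// lte_mul_pinfty// ge0_fin_numE.
Qed.

HB.instance Definition _ :=
  @Measure_isSigmaFinite.Build _ _ _ lebesgue_cons lebesgue_cons_sigma_finite.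
End row_cons.

(* Lebesgue measure on the Borel sets of R^n, as an iterated product measure;
   [lebesgue_row 0] is the unit mass of the one-point space. *)
Fixpoint lebesgue_row {R : realType} (n : nat) :
    {sigma_finite_measure set 'rV[R]_n -> \bar R} :=
  if n is m.+1 then lebesgue_cons (lebesgue_row m) else \d_(0 : 'rV[R]_0).

Section euclidean.
Context {R : realType} {d : nat}.
Implicit Types x y : 'rV[R]_d.

Definition dotp x y : R := \sum_j x ord0 j * y ord0 j.
Definition enorm x : R := Num.sqrt (dotp x x).
Definition diam (D : set 'rV[R]_d) : R :=
  sup [set enorm (p.1 - p.2) | p in D `*` D].
Definition inradius (D : set 'rV[R]_d) : R :=
  sup [set r | 0 < r /\ exists z, [set x | enorm (x - z) < r] `<=` D].
Definition boundary (D : set 'rV[R]_d) : set 'rV[R]_d := closure D `\` D°.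

End euclidean.

(* Near every boundary point, in suitable orthonormal coordinates
   [(z - x) *m Q], the domain is the strict epigraph of a Lipschitz function:
   coordinate [k] is the height, [col' k] the remaining coordinates. *)
Definition lipschitz_domain (R : realType) (d : nat) (Om : set 'rV[R]_d) : Prop :=
  [/\ Om !=set0, open Om, connected Om, bounded_set Om &
    forall x, boundary Om x ->
      exists (r L : R) (Q : 'M[R]_d) (k : 'I_d) (gam : 'rV[R]_d.-1 -> R),
        [/\ 0 < r, Q *m Q^T = 1%:M,
            forall u w, `|gam u - gam w| <= L * enorm (u - w)
          & forall z, enorm (z - x) < r ->
              (Om z <-> gam (col' k ((z - x) *m Q)) < ((z - x) *m Q) ord0 k)]].

Section function_spaces.
Context {R : realType} {n : nat}.
Local Notation E := 'rV[R]_n.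
Local Notation leb := (@lebesgue_row R n).
Implicit Types (Om : set E) (w u psi : E -> R) (j : 'I_n).

Definition partial j w : E -> R := fun x => 'D_(delta_mx ord0 j) w x.

Definition smooth w : Prop := forall s : seq 'I_n,
  let ws := foldr partial w s in
  continuous ws /\ forall x j, derivable ws x (delta_mx ord0 j).

Definition test_function Om psi : Prop :=
  smooth psi /\ exists C, [/\ compact C, C `<=` Om & forall x, ~ C x -> psi x = 0].

Definition loc_integrable Om w : Prop :=
  measurable_fun Om w /\
  forall C, compact C -> C `<=` Om -> leb.-integrable C (EFin \o w).

(* [u] is the j-th distributional derivative of [w] in [Om]. *)
Definition weak_partial Om j w u : Prop :=
  [/\ loc_integrable Om w, loc_integrable Om u &
    forall psi, test_function Om psi ->
      \int[leb]_(x in Om) (w x * partial j psi x)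
        = - \int[leb]_(x in Om) (u x * psi x)].

Definition weak_laplacian Om w u : Prop :=
  [/\ loc_integrable Om w, loc_integrable Om u &
    forall psi, test_function Om psi ->
      \int[leb]_(x in Om) (w x * \sum_j partial j (partial j psi) x)
        = \int[leb]_(x in Om) (u x * psi x)].

(* A representative of the weak gradient (unique up to null sets); the
   coordinates without a weak derivative are set to 0. *)
Definition wgrad Om w : E -> E :=
  fun x => \row_j xget (cst 0) [set u | weak_partial Om j w u] x.

Definition linf Om w : \bar R := 'N[leb]_+oo%E [EFin \o (w \_ Om)].

Definition Linf Om w : Prop := measurable_fun Om w /\ (linf Om w < +oo)%E.

Definition L2 Om w : Prop :=
  measurable_fun Om w /\ (\int[leb]_(x in Om) ((w x) ^+ 2)%:E < +oo)%E.

Definition H1 Om w : Prop :=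
  L2 Om w /\ forall j, exists u, weak_partial Om j w u /\ L2 Om u.

Definition W1inf Om w : Prop :=
  Linf Om w /\ forall j, exists u, weak_partial Om j w u /\ Linf Om u.

Definition W1inf_norm Om w : \bar R :=
  (linf Om w + linf Om (fun x => enorm (wgrad Om w x)))%E.

Definition ip Om u w : R := \int[leb]_(x in Om) (u x * w x).

Definition ip_grad Om u w : R :=
  \int[leb]_(x in Om) dotp (wgrad Om u x) (wgrad Om w x).

End function_spaces.

Section space_time.
Context {R : realType} {d : nat}.
Implicit Types (Om : set 'rV[R]_d) (w : R -> 'rV[R]_d -> R).

(* Membership in W^{1,oo}([0,T] x closure Om), by the continuous
   representative, since the functions are evaluated pointwise. *)
Definition W1inf_cyl (T : R) Om w : Prop :=
  {within `[0, T] `*` closure Om,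
     continuous (fun p : R * 'rV[R]_d => w p.1 p.2)} /\
  W1inf [set z : 'rV[R]_(1 + d) |
           0 < lsubmx z ord0 ord0 < T /\ Om (rsubmx z)]
        (fun z => w (lsubmx z ord0 ord0) (rsubmx z)).

End space_time.

Section finite_elements.
Context {R : realType} {d : nat}.
Local Notation E := 'rV[R]_d.

(* A simplicial mesh; a cell is given by the set of its vertices. *)
Record mesh := Mesh {
  nnode : nat;
  node : 'I_nnode -> E;
  cells : {set {set 'I_nnode}} }.

Context (M : mesh).
Implicit Types (K : {set 'I_(nnode M)}) (l : 'I_(nnode M)).

(* [lam] are barycentric coordinates of [x] in the simplex spanned by [K]. *)
Definition bary K (x : E) (lam : 'I_(nnode M) -> R) : Prop :=
  [/\ forall l, 0 <= lam l, forall l, l \notin K -> lam l = 0,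
      \sum_l lam l = 1 & x = \sum_l lam l *: node l].

Definition simplex K : set E := [set x | exists lam, bary K x lam].

Definition affinely_independent K : Prop :=
  forall lam : 'I_(nnode M) -> R, (forall l, l \notin K -> lam l = 0) ->
    \sum_l lam l = 0 -> \sum_l lam l *: node l = 0 -> forall l, lam l = 0.

Definition mesh_of (Om : set E) : Prop :=
  [/\ forall K, K \in cells M -> #|K| = d.+1 /\ affinely_independent K,
      forall K K', K \in cells M -> K' \in cells M ->
        simplex K `&` simplex K' = simplex (K :&: K'),
      closure Om = \bigcup_(K in [set` cells M]) simplex K
    & forall l, exists2 K, K \in cells M & l \in K].

Definition mesh_size : R := \big[Num.max/0]_(K in cells M) diam (simplex K).

(* On a cell, the hat function of [l] is the barycentric coordinate of [l];
   outside the mesh it is 0. *)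
Definition hat l : E -> R := fun x =>
  xget 0 [set r | exists K lam, [/\ K \in cells M, bary K x lam & r = lam l]].

Definition hat1 (Om : set E) l : E -> R :=
  fun x => hat l x / \int[lebesgue_row d]_(z in Om) `|hat l z|.

(* The element of the finite element space with nodal values [U]; below,
   finite element functions are identified with their nodal values. *)
Definition fe (U : 'rV[R]_(nnode M)) : E -> R :=
  fun x => \sum_l U ord0 l * hat l x.

(* [N] is the dimension of the subspace of functions vanishing on the
   boundary, and the interior nodes are those of index less than [N]. *)
Definition interior_nodes (Om : set E) (N : nat) : Prop :=
  (forall l, Om (node l) <-> (l < N)%N) /\
  exists V0 : {vspace 'rV[R]_(nnode M)},
    (forall U, U \in V0 <-> forall x, boundary Om x -> fe U x = 0) /\
    \dim V0 = N.

End finite_elements.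
Arguments mesh R d : clear implicits.

Definition shape_regular (R : realType) (d : nat) (M : nat -> mesh R d) : Prop :=
  exists sigma : R, forall i K, K \in cells (M i) ->
    diam (simplex K) <= sigma * inradius (simplex K).

Section parameter_dependence.
Context {R : realType} {d : nat} {A B : metricType R} {V : normedModType R}.
Implicit Types (D : set 'rV[R]_d) (F : A -> B -> 'rV[R]_d -> V).

Definition sup_continuous D F : Prop :=
  forall (p : A * B) (e : R), 0 < e ->
    \forall q \near p, forall x, D x -> `|F q.1 q.2 x - F p.1 p.2 x| <= e.

Definition equicontinuous_on D F : Prop :=
  forall x, D x -> forall e : R, 0 < e ->
    \forall z \near within D (nbhs x),
      forall al be, `|F al be z - F al be x| <= e.

Definition Linf_continuous D F : Prop :=
  forall p : A * B,
    linf D (fun x => `|F q.1 q.2 x - F p.1 p.2 x|) @[q --> p] --> 0%E.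

End parameter_dependence.

Record problem_data (R : realType) (d : nat) (Om : set 'rV[R]_d) (T : R)
    (A B : metricType R) (a c f : A -> B -> 'rV[R]_d -> R)
    (b : A -> B -> 'rV[R]_d -> 'rV[R]_d) (vT g : 'rV[R]_d -> R) : Prop := {
  pd_dim : (2 <= d)%N;
  pd_domain : lipschitz_domain Om;
  pd_T : 0 < T;
  pd_compactA : compact [set: A];
  pd_compactB : compact [set: B];
  (* implicit in taking suprema over A and infima over B *)
  pd_nonempty : [set: A] !=set0 /\ [set: B] !=set0;
  pd_cont_a : forall al be, {within closure Om, continuous (a al be)};
  pd_cont_b : forall al be, {within closure Om, continuous (b al be)};
  pd_cont_c : forall al be, {within closure Om, continuous (c al be)};
  pd_cont_f : forall al be, {within closure Om, continuous (f al be)};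
  pd_a_ge0 : forall al be x, closure Om x -> 0 <= a al be x;
  pd_param_a : sup_continuous (closure Om) a;
  pd_param_b : sup_continuous (closure Om) b;
  pd_param_c : sup_continuous (closure Om) c;
  pd_param_f : sup_continuous (closure Om) f;
  pd_equi_a : equicontinuous_on (closure Om) a;
  pd_equi_b : equicontinuous_on (closure Om) b;
  pd_equi_c : equicontinuous_on (closure Om) c;
  pd_equi_f : equicontinuous_on (closure Om) f;
  pd_vT : {within closure Om, continuous vT};
  (* the continuous representative of g is chosen *)
  pd_g_cont : continuous g;
  pd_g_W1inf : W1inf setT g;
  pd_g_laplacian : exists u, weak_laplacian Om g u /\ Linf Om u;
  pd_compat : forall x, boundary Om x -> vT x = g x }.

Record discretisation (R : realType) (d : nat) (Om : set 'rV[R]_d) (T : R)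
    (M : nat -> mesh R d) (N : nat -> nat) (h : nat -> R) (K : nat -> nat)
    : Prop := {
  ds_mesh : forall i, mesh_of (M i) Om;
  ds_shape : shape_regular M;
  ds_nodes : forall i, interior_nodes (M i) Om (N i);
  ds_mesh_size : mesh_size (M i) @[i --> \oo] --> (0 : R);
  ds_step_gt0 : forall i, 0 < h i;
  ds_step : h i @[i --> \oo] --> (0 : R);
  ds_final : forall i, (K i)%:R * h i = T }.

(* [P i w] are the nodal values of the projection of [w].  The conditions
   bear on H^1(Om) only; elsewhere [P i] is an arbitrary extension. *)
Record projections (R : realType) (d : nat) (Om : set 'rV[R]_d)
    (M : nat -> mesh R d) (N : nat -> nat)
    (P : forall i, ('rV[R]_d -> R) -> 'rV[R]_(nnode (M i))) : Prop := {
  pr_ae : forall i w1 w2, H1 Om w1 -> H1 Om w2 ->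
    {ae lebesgue_row d, forall x, Om x -> w1 x = w2 x} -> P i w1 = P i w2;
  pr_linear : forall i (r : R) w1 w2, H1 Om w1 -> H1 Om w2 ->
    P i (fun x => r * w1 x + w2 x) = r *: P i w1 + P i w2;
  pr_elliptic : forall i w (l : 'I_(nnode (M i))), H1 Om w -> (l < N i)%N ->
    ip_grad Om (fe (P i w)) (hat1 Om l) = ip_grad Om w (hat1 Om l);
  pr_stable : exists C : R, 0 <= C /\ forall w, smooth w -> forall i,
    (W1inf_norm Om (fe (P i w)) <= C%:E * W1inf_norm Om w)%E;
  pr_approx : forall w, smooth w ->
    W1inf_norm Om (fun x => fe (P i w) x - w x) @[i --> \oo] --> 0%E }.

(* One half (explicit or implicit) of the splitting of the coefficients; the
   diffusion coefficient is only given at the nodes. *)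
Record coefs (R : realType) (d : nat) (A B : Type) (M : mesh R d) := Coefs {
  ca : A -> B -> 'I_(nnode M) -> R;
  cb : A -> B -> 'rV[R]_d -> 'rV[R]_d;
  cc : A -> B -> 'rV[R]_d -> R }.

Section operators.
Context {R : realType} {d : nat} (Om : set 'rV[R]_d) {A B : Type}.
Context {M : mesh R d} (N : nat).
Implicit Types (s : coefs A B M) (w : 'rV[R]_d -> R) (l : 'I_(nnode M)).

Definition galerkin s al be w l : R :=
  ca s al be l * ip_grad Om w (hat1 Om l) +
  ip Om (fun x => - dotp (cb s al be x) (wgrad Om w x) + cc s al be x * w x)
     (hat1 Om l).

Definition opE s al be w l : R := if (l < N)%N then galerkin s al be w l else 0.

Definition opI s al be w l : R :=
  if (l < N)%N then galerkin s al be w l else w (node l).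

Definition opF (fi : A -> B -> 'rV[R]_d -> R) (Pg : 'rV[R]_(nnode M)) al be l
    : R :=
  if (l < N)%N then ip Om (fi al be) (hat1 Om l) else Pg ord0 l.

Definition consistency_error (a c f fi : A -> B -> 'rV[R]_d -> R)
    (b : A -> B -> 'rV[R]_d -> 'rV[R]_d) (ex im : coefs A B M) al be : \bar R :=
  (\big[maxe/0]_(l < nnode M | (l < N)%N)
     linf (closure [set x | hat1 Om l x != 0%R])
          (fun x => a al be x - (ca ex al be l + ca im al be l))%R
   + linf Om (fun x => enorm (b al be x - (cb ex al be x + cb im al be x)))%R
   + linf Om (fun x => c al be x - (cc ex al be x + cc im al be x))%R
   + linf Om (fun x => f al be x - fi al be x)%R)%E.

End operators.

Record admissible_coefs (R : realType) (d : nat) (Om : set 'rV[R]_d)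
    (A B : metricType R) (M : mesh R d) (s : coefs A B M) : Prop := {
  ac_b_Linf : forall al be j, Linf Om (fun x => cb s al be x ord0 j);
  ac_c_Linf : forall al be, Linf Om (cc s al be);
  ac_a_param : forall l, continuous (fun p : A * B => ca s p.1 p.2 l);
  ac_b_param : Linf_continuous Om (cb s);
  ac_c_param : Linf_continuous Om (cc s);
  ac_c_ge0 : forall al be,
    {ae lebesgue_row d, forall x, Om x -> 0 <= cc s al be x} }.

Record splitting (R : realType) (d : nat) (Om : set 'rV[R]_d)
    (A B : metricType R) (a c f : A -> B -> 'rV[R]_d -> R)
    (b : A -> B -> 'rV[R]_d -> 'rV[R]_d) (M : nat -> mesh R d) (N : nat -> nat)
    (ex im : forall i, coefs A B (M i)) (fi : nat -> A -> B -> 'rV[R]_d -> R)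
    : Prop := {
  sp_ex : forall i, admissible_coefs Om (ex i);
  sp_im : forall i, admissible_coefs Om (im i);
  sp_f_Linf : forall i al be, Linf Om (fi i al be);
  sp_f_param : forall i, Linf_continuous Om (fi i);
  sp_consistent :
    ereal_sup [set consistency_error Om (N i) a c f (fi i) b (ex i) (im i) p.1 p.2
              | p in [set: A * B]] @[i --> \oo] --> 0%E;
  sp_bound : exists gamma : R, forall i al be,
    (linf Om (cc (ex i) al be) + linf Om (cc (im i) al be) <= gamma%:E)%E }.

Record monotone_scheme (R : realType) (d : nat) (Om : set 'rV[R]_d) (A B : Type)
    (M : nat -> mesh R d) (N : nat -> nat) (h : nat -> R)
    (ex im : forall i, coefs A B (M i)) : Prop := {
  mn_offdiag : forall i al be (l m : 'I_(nnode (M i))), l != m ->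
    opE Om (N i) (ex i) al be (hat m) l <= 0;
  mn_cfl : forall i al be (l m : 'I_(nnode (M i))),
    h i * opE Om (N i) (ex i) al be (hat m) l - (l == m)%:R <= 0;
  mn_local : forall i al be (U : 'rV[R]_(nnode (M i))) (l : 'I_(nnode (M i))),
    (l < N i)%N ->
    (\forall x \near node l, fe U (node l) <= fe U x) -> fe U (node l) <= 0 ->
    opI Om (N i) (im i) al be (fe U) l <= 0 }.

Record numerical_solution (R : realType) (d : nat) (Om : set 'rV[R]_d)
    (A B : Type) (vT g : 'rV[R]_d -> R) (M : nat -> mesh R d) (N : nat -> nat)
    (h : nat -> R) (K : nat -> nat)
    (P : forall i, ('rV[R]_d -> R) -> 'rV[R]_(nnode (M i)))
    (ex im : forall i, coefs A B (M i)) (fi : nat -> A -> B -> 'rV[R]_d -> R)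
    (v : forall i, nat -> 'rV[R]_(nnode (M i))) : Prop := {
  ns_final : forall i, v i (K i) = P i vT;
  ns_boundary : forall i k, (k < K i)%N -> forall x, boundary Om x ->
    fe (v i k) x = fe (P i g) x;
  ns_scheme : forall i k, (k < K i)%N ->
    forall l : 'I_(nnode (M i)),
    ((- ((v i k.+1 ord0 l - v i k ord0 l) / h i))%:E +
     ereal_inf [set
       ereal_sup [set
         (opE Om (N i) (ex i) al be (fe (v i k.+1)) l +
          opI Om (N i) (im i) al be (fe (v i k)) l -
          opF Om (N i) (fi i) (P i g) al be l)%:E
       | al in [set: A]]
     | be in [set: B]] = 0)%E }.

Section envelopes.
Context {R : realType} {d : nat} (M : nat -> mesh R d) (h : nat -> R).
Context (K : nat -> nat) (v : forall i, nat -> 'rV[R]_(nnode (M i))).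

(* Time steps [k i] and nodes [l i], i = 0, 1, ..., converging to (t, x). *)
Definition approaching (t : R) (x : 'rV[R]_d) (k : nat -> nat)
    (l : forall i, 'I_(nnode (M i))) : Prop :=
  [/\ forall i, (k i <= K i)%N, (k i)%:R * h i @[i --> \oo] --> t
    & node (l i) @[i --> \oo] --> x].

Definition upper_envelope t x : \bar R :=
  ereal_sup [set e | exists k l, approaching t x k l /\
    e = limn_esup (fun i => (v i (k i) ord0 (l i))%:E)].

Definition lower_envelope t x : \bar R :=
  ereal_inf [set e | exists k l, approaching t x k l /\
    e = limn_einf (fun i => (v i (k i) ord0 (l i))%:E)].

End envelopes.

(* [zeta y e] and [xi y e] are the functions attached to y in [omega], e > 0.
   The minimisers [q] and maximisers [r] are one choice for each t, e. *)
Record barrier (R : realType) (d : nat) (Om omega : set 'rV[R]_d) (T : R)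
    (g : 'rV[R]_d -> R) (M : nat -> mesh R d) (h : nat -> R) (K : nat -> nat)
    (P : forall i, ('rV[R]_d -> R) -> 'rV[R]_(nnode (M i)))
    (v : forall i, nat -> 'rV[R]_(nnode (M i)))
    (zeta xi : 'rV[R]_d -> R -> R -> 'rV[R]_d -> R) : Prop := {
  br_zeta : forall y (e : R), omega y -> 0 < e -> W1inf_cyl T Om (zeta y e);
  br_xi : forall y (e : R), omega y -> 0 < e -> W1inf_cyl T Om (xi y e);
  br_1a : forall y (e : R), omega y -> 0 < e ->
    exists i0 : nat, forall i k, (i0 <= i)%N -> (k <= K i)%N ->
      let D := fun x => fe (v i k) x - fe (P i (zeta y e (k%:R * h i))) x in
      exists2 z, boundary Om z & forall x, closure Om x -> D z <= D x;
  br_1b : forall y (t : R), omega y -> 0 <= t <= T ->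
    exists q : R -> 'rV[R]_d,
      [/\ forall e : R, 0 < e -> boundary Om (q e) /\
            forall z, boundary Om z ->
              g (q e) - zeta y e t (q e) <= g z - zeta y e t z,
          q e @[e --> 0^'+] --> y
        & exists2 L : R, 0 <= L &
            zeta y e t y - zeta y e t (q e) @[e --> 0^'+] --> L];
  br_2a : forall y (e : R), omega y -> 0 < e ->
    exists i0 : nat, forall i k, (i0 <= i)%N -> (k <= K i)%N ->
      let D := fun x => fe (v i k) x - fe (P i (xi y e (k%:R * h i))) x in
      exists2 z, boundary Om z & forall x, closure Om x -> D x <= D z;
  br_2b : forall y (t : R), omega y -> 0 <= t <= T ->
    exists r : R -> 'rV[R]_d,
      [/\ forall e : R, 0 < e -> boundary Om (r e) /\
            forall z, boundary Om z ->
              g z - xi y e t z <= g (r e) - xi y e t (r e),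
          r e @[e --> 0^'+] --> y
        & exists2 L : R, L <= 0 &
            xi y e t y - xi y e t (r e) @[e --> 0^'+] --> L] }.

(* Uniform convergence, over all time steps and the closed domain, of the
   projections of a time-dependent function.  [pr_stable] and [pr_approx]
   only concern smooth functions and do not imply it for others. *)
Definition projections_converge (R : realType) (d : nat) (Om : set 'rV[R]_d)
    (M : nat -> mesh R d) (h : nat -> R) (K : nat -> nat)
    (P : forall i, ('rV[R]_d -> R) -> 'rV[R]_(nnode (M i)))
    (w : R -> 'rV[R]_d -> R) : Prop :=
  forall e : R, 0 < e -> \forall i \near \oo,
    forall k x, (k <= K i)%N -> closure Om x ->
      `|fe (P i (w (k%:R * h i))) x - w (k%:R * h i) x| <= e.

(* Main.v *)
Require Import Defs.
From HB Require Import structures.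
From mathcomp Require Import all_boot all_order all_algebra.
From mathcomp Require Import all_classical all_reals all_analysis.
From mathcomp Require Import lra.
Import Order.TTheory GRing.Theory Num.Theory.
Import numFieldNormedType.Exports.
Local Open Scope classical_set_scope.
Local Open Scope ring_scope.
Set Implicit Arguments. Unset Strict Implicit.

(** The claim is that the nodal values [v i (k i) ord0 (l i)] converge to [g y]
    along every sequence of time steps and nodes approaching [(t, y)] with
    [y] in [omega]; the set of limit values whose extrema are the envelopes
    is then reduced to [g y].  It is not empty because the nodes and the time
    steps become dense ([exists_approaching]).

    For the lower bound, fix a barrier [zeta y e].  The difference of [v i] and
    the projection of the barrier is minimal at a boundary point [z], where
    [v i] equals the projection of [g].  Replacing projections by their limits,
    the value of [v i] at a node near [y] is, up to a small error, at least
    [zeta t y - zeta t z + g z], hence at least [zeta t y - zeta t q + g q] for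
    the minimiser [q] of [g - zeta t] on the boundary.  As [e] tends to 0, [q]
    tends to [y] and [zeta t y - zeta t q] to a nonnegative limit, which leaves
    [g y].  Moving [s_i] to [t] in [zeta s_i z] must be uniform in the unknown
    point [z]; this is compactness of the boundary ([uniform_slice]).  The
    argument is [barrier_bound]; the upper bound is the same lemma applied to
    the opposite functions.

    At the final time the boundary values are those of the projection of [vT],
    and the equality of [vT] and [g] on the boundary does not by itself pass to
    the projections.  The scheme enforces it: at a boundary node the scheme reads
    [- d_i v + v - P_i g = 0], and the last two terms cancel one step before the
    final time, so [d_i v] vanishes and the value at the final time is the one
    before it ([boundary_node_stationary]).  Passing from nodes to all boundary
    points requires that a finite element function vanishing at the boundary
    nodes vanishes on the boundary, which is where the dimension of the space of
    functions vanishing on the boundary enters ([fe_boundary0]). *)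

(** * Lower bounds from barriers *)

(** Continuity at each [(t, z)] only gives a neighbourhood of times depending on
    [z]; compactness of [C] makes it uniform. *)
Lemma uniform_slice (R : realType) (X : topologicalType) (I : set R)
    (D C : set X) (phi : R -> X -> R) (s : nat -> R) (t : R) :
    compact C -> C `<=` D ->
    {within I `*` D, continuous (fun p : R * X => phi p.1 p.2)} ->
    I t -> (forall i, I (s i)) -> s i @[i --> \oo] --> t ->
  forall e, 0 < e ->
    \forall i \near \oo, forall z, C z -> `|phi (s i) z - phi t z| <= e.
Proof.
move=> cC CD /subspace_continuousP cphi It Is st e e0.
have near_slice : \forall i \near \oo, forall z, C z ->
    D z -> `|phi (s i) z - phi t z| <= e.
  apply: ((compact_near_coveringP C).1 cC nat \oo
    (fun i z => D z -> `|phi (s i) z - phi t z| <= e)).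
  move=> z Cz.
  have e2 : 0 < e / 2 by rewrite divr_gt0.
  have /cvgrPdist_lt /(_ _ e2) := cphi (t, z) (conj It (CD _ Cz)).
  rewrite near_withinE => -[[U V] [/= Ut Vz] UV].
  exists (V, [set i | U (s i)]); first by split => //=; exact: st.
  move=> [z' i] [/= Vz' Usi] Dz'.
  have h1 := UV (s i, z') (conj Usi Vz') (conj (Is i) Dz').
  have h2 := UV (t, z') (conj (nbhs_singleton Ut) Vz') (conj It Dz').
  rewrite /= in h1 h2.
  have := ler_distD (phi t z) (phi (s i) z') (phi t z').
  rewrite [`|phi (s i) z' - phi t z|]distrC.
  lra.
near=> i => z Cz.
by apply: (near near_slice i) => //; exact: CD.
Unshelve. all: by end_near. Qed.

(** One-sided comparison with a family of barriers [phi e].  The sequences [V],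
    [G], [Phi e] stand for the discrete solution, the projected boundary data
    and the projected barrier at the times [s i].  Stating it for arbitrary
    functions allows the upper bound to be obtained by changing all signs. *)
Lemma barrier_bound (R : realType) (X : topologicalType) (I : set R)
    (D C : set X) (g : X -> R) (phi : R -> R -> X -> R)
    (s : nat -> R) (x : nat -> X) (t : R) (y : X) (q : R -> X) (L : R)
    (V G : nat -> X -> R) (Phi : R -> nat -> X -> R) :
    compact C -> C `<=` D -> {for y, continuous g} ->
    (forall i, I (s i)) -> (forall i, D (x i)) -> I t -> D y ->
    s i @[i --> \oo] --> t -> x i @[i --> \oo] --> y ->
    (forall e, 0 < e ->
      {within I `*` D, continuous (fun p : R * X => phi e p.1 p.2)}) ->
    (forall e, 0 < e ->
      forall z, C z -> g (q e) - phi e t (q e) <= g z - phi e t z) ->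
    q e @[e --> 0^'+] --> y -> 0 <= L ->
    phi e t y - phi e t (q e) @[e --> 0^'+] --> L ->
    (forall i z, C z -> V i z = G i z) ->
    (forall dl, 0 < dl ->
      \forall i \near \oo, forall z, D z -> `|G i z - g z| <= dl) ->
    (forall e dl, 0 < e -> 0 < dl ->
      \forall i \near \oo, forall z, D z -> `|Phi e i z - phi e (s i) z| <= dl) ->
    (forall e, 0 < e -> \forall i \near \oo, exists2 z, C z &
      forall w, D w -> V i z - Phi e i z <= V i w - Phi e i w) ->
  forall dl, 0 < dl -> \forall i \near \oo, g y - dl <= V i (x i).
Proof.
move=> cC CD cg Is Dx It Dy st xy cphi qmin qy L0 qL VG Gg Phiphi Vmin dl dl0.
(* Seven errors: two in the choice of e, one each in moving (s i, x i) to
   (t, y) and s i to t at the minimiser z, three from G and Phi. *)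
have d7 : 0 < dl / 7 by rewrite divr_gt0.
have gq : g (q e) @[e --> 0^'+] --> g y by apply: continuous_cvg.
have [e [e0 Lq gyq]] : exists e, [/\ 0 < e,
    L - dl / 7 < phi e t y - phi e t (q e) & g y - dl / 7 < g (q e)].
  have : \forall e \near 0^'+, [/\ 0 < e,
    L - dl / 7 < phi e t y - phi e t (q e) & g y - dl / 7 < g (q e)].
    near=> e; split; first by near: e; exact: nbhs_right_gt.
    - near: e; apply: (cvgr_gt _ qL); lra.
    - near: e; apply: (cvgr_gt _ gq); lra.
  by move=> /filter_ex.
have slice := uniform_slice cC CD (cphi e e0) It Is st d7.
have point : \forall i \near \oo, phi e t y - dl / 7 < phi e (s i) (x i).
  have /subspace_continuousP /(_ (t, y) (conj It Dy)) cty := cphi e e0.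
  have sx : (s i, x i) @[i --> \oo] --> within (I `*` D) (nbhs (t, y)).
    move=> U; rewrite /within /= => -[[U1 U2] [/= Ut Uy] UU].
    have nU1 : \forall i \near \oo, U1 (s i) by exact: st.
    have nU2 : \forall i \near \oo, U2 (x i) by exact: xy.
    by apply: filterS2 nU1 nU2 => i U1i U2i; apply: (UU (s i, x i)); split=> /=.
  have lim : phi e (s i) (x i) @[i --> \oo] --> phi e t y.
    exact: cvg_comp sx cty.
  by apply: (cvgr_gt _ lim); lra.
near=> i.
have [z Cz /(_ _ (Dx i))] : exists2 z, C z &
    forall w, D w -> V i z - Phi e i z <= V i w - Phi e i w.
  by near: i; exact: Vmin.
have Gz : `|G i z - g z| <= dl / 7.
  by move: z {Cz} (CD _ Cz); near: i; exact: Gg.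
have Phi_near w : D w -> `|Phi e i w - phi e (s i) w| <= dl / 7.
  by move: w; near: i; exact: Phiphi.
have sz : `|phi e (s i) z - phi e t z| <= dl / 7.
  by move: z Cz {Gz}; near: i; exact: slice.
have px : phi e t y - dl / 7 < phi e (s i) (x i) by near: i; exact: point.
have := qmin e e0 z Cz; rewrite (VG _ _ Cz).
move: Gz (Phi_near _ (Dx i)) (Phi_near _ (CD _ Cz)) sz; rewrite !ler_norml.
by move=> /andP[? ?] /andP[? ?] /andP[? ?] /andP[? ?]; lra.
Unshelve. all: by end_near. Qed.

(** * Nodal values of finite element functions *)

Section mesh_theory.
Context {R : realType} {d : nat} (M : mesh R d) (Om : set 'rV[R]_d).
Context (hM : mesh_of M Om).
Implicit Types (K : {set 'I_(nnode M)}) (l m : 'I_(nnode M)).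
Implicit Types (U W : 'rV[R]_(nnode M)).

Lemma bary_unique K (x : 'rV[R]_d) lam mu : affinely_independent K ->
  bary K x lam -> bary K x mu -> forall l, lam l = mu l.
Proof.
move=> aff [_ lam0 lam1 xlam] [_ mu0 mu1 xmu] l.
apply/eqP; rewrite -subr_eq0; apply/eqP; move: l.
apply: (aff (fun l => lam l - mu l)).
- by move=> l lK; rewrite lam0// mu0// subrr.
- by rewrite sumrB lam1 mu1 subrr.
- under eq_bigr do rewrite scalerBl.
  by rewrite sumrB -xlam -xmu subrr.
Qed.

Lemma bary_vertex K m : m \in K -> bary K (node m) (fun l => (l == m)%:R).
Proof.
move=> mK; split.
- by move=> l; case: eqP.
- by move=> l; case: eqP => // ->; rewrite mK.
- by rewrite (bigD1 m)//= eqxx big1 ?addr0// => l /negPf ->.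
- rewrite (bigD1 m)//= eqxx scale1r big1 ?addr0// => l /negPf ->.
  by rewrite scale0r.
Qed.

Lemma baryS K K' (x : 'rV[R]_d) lam :
  K \subset K' -> bary K x lam -> bary K' x lam.
Proof.
move=> KK' [p0 s0 s1 e]; split => // l lK'; apply: s0.
by apply: contra lK' => /(fintype.subsetP KK').
Qed.

(** Cells meet along common faces: if [node m] lies in [K] and is a vertex of
    [K'], it has barycentric coordinates supported in [K :&: K'], and uniqueness
    of coordinates in [K'] forces [m] into the support. *)
Lemma vertex_mem K m : K \in cells M -> simplex K (node m) -> m \in K.
Proof.
case: hM => aff conf _ cover KM Km.
have [K' K'M mK'] := cover m.
have : simplex (K :&: K') (node m).
  by rewrite -conf//; split => //; eexists; exact: bary_vertex.
move=> [mu bmu]; apply: contraT => mK.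
have := bary_unique (aff _ K'M).2 (baryS (finset.subsetIr _ _) bmu) (bary_vertex mK') m.
have -> : mu m = 0 by case: bmu => _ -> //; rewrite inE (negPf mK).
rewrite eqxx /= => /esym/eqP.
by rewrite oner_eq0.
Qed.

Lemma hat_node l m : hat l (node m) = (l == m)%:R.
Proof.
case: (hM) => aff _ _ cover.
apply: xget_unique.
  have [K KM mK] := cover m.
  by exists K, (fun l => (l == m)%:R); split => //; exact: bary_vertex.
move=> _ [K [lam [KM b ->]]].
have mK : m \in K by apply: vertex_mem => //; exists lam.
exact: bary_unique (aff _ KM).2 b (bary_vertex mK) l.
Qed.

Lemma fe_node U m : fe U (node m) = U ord0 m.
Proof.
rewrite /fe (bigD1 m)//= hat_node eqxx mulr1 big1 ?addr0// => l lm.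
by rewrite hat_node (negPf lm) mulr0.
Qed.

Lemma feB U W x : fe (U - W) x = fe U x - fe W x.
Proof.
by rewrite /fe -sumrB; apply: eq_bigr => l _; rewrite !mxE mulrBl.
Qed.

Lemma node_closure l : closure Om (node l).
Proof.
case: hM => _ _ -> /(_ l)[K KM lK].
by exists K => //; eexists; exact: bary_vertex.
Qed.

Lemma noninterior_node_boundary N l : open Om -> interior_nodes M Om N ->
  ~~ (l < N)%N -> boundary Om (node l).
Proof.
move=> oOm [hN _] lN; split; first exact: node_closure.
by move=> /interior_subset /hN; exact/negP.
Qed.

(** The functions vanishing on the boundary form a subspace [V0] of those
    vanishing at the boundary nodes.  The latter space is spanned by the unit
    vectors of the interior nodes, so its dimension is at most [N], which is the
    dimension of [V0]; the two spaces coincide. *)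
Lemma fe_boundary0 N U : open Om -> interior_nodes M Om N ->
  (forall l, ~~ (l < N)%N -> U ord0 l = 0) ->
  forall x, boundary Om x -> fe U x = 0.
Proof.
move=> oOm intN U0; have [hN [V0 [V0P dimV0]]] := intN.
pose S := [seq delta_mx ord0 l : 'rV[R]_(nnode M) | l <- enum 'I_(nnode M) & (l < N)%N].
have sub W : (forall l, ~~ (l < N)%N -> W ord0 l = 0) -> W \in <<S>>%VS.
  move=> W0; rewrite (row_sum_delta W) memv_suml// => l _.
  have [lN|lN] := boolP (l < N)%N; last by rewrite W0// scale0r mem0v.
  apply/memvZ/memv_span/mapP; exists l => //.
  by rewrite mem_filter lN mem_enum.
have V0S : (V0 <= <<S>>)%VS.
  apply/subvP => W /V0P W0; apply: sub => l lN.
  by rewrite -fe_node W0//; exact: noninterior_node_boundary lN.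
have dimS : (\dim <<S>> <= \dim V0)%N.
  rewrite dimV0 (leq_trans (dim_span _))// size_map.
  rewrite -(size_map (@nat_of_ord (nnode M))) (leq_trans (uniq_leq_size (s2 := iota 0 N) _ _))//.
  - rewrite (map_inj_uniq (@ord_inj _)); apply: filter_uniq; exact: enum_uniq.
  - move=> _ /mapP[l + ->]; rewrite mem_filter mem_iota /= => /andP[lN _].
    exact: lN.
  - by rewrite size_iota.
by apply/V0P; have /eqP -> : V0 == <<S>>%VS; [rewrite eqEdim V0S|exact: sub].
Qed.

End mesh_theory.
(** * Density of the nodes *)

Section euclidean_theory.
Context {R : realType} {d : nat}.
Implicit Types x : 'rV[R]_d.

Lemma le_norm_enorm x : `|x| <= enorm x.
Proof.
rewrite /Num.Def.normr /= mx_normrE; apply: bigmax_le => [|[i j] _] /=.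
  exact: sqrtr_ge0.
rewrite -sqrtr_sqr ler_wsqrtr// (ord1 i) /dotp (bigD1 j)//= -expr2 lerDl.
by apply: sumr_ge0 => k _; rewrite -expr2 sqr_ge0.
Qed.

Lemma le_enorm_norm x : enorm x <= Num.sqrt (`|x| ^+ 2 *+ d).
Proof.
rewrite ler_wsqrtr// -[X in _ *+ X]card_ord -sumr_const.
apply: ler_sum => j _; rewrite -expr2 -[leLHS]ger0_norm ?sqr_ge0// normrX.
rewrite lerXn2r ?nnegrE//.
rewrite [leRHS]/Num.Def.normr /= mx_normrE.
exact: (le_bigmax _ (fun ij => `|x ij.1 ij.2|) (ord0, j)).
Qed.

Lemma bounded_setP (D : set 'rV[R]_d) :
  bounded_set D <-> exists r : R, forall x, D x -> `|x| <= r.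
Proof.
split=> [/pinfty_ex_gt0[r _ Dr]|[r Dr]]; first by exists r.
have large : \forall r' \near +oo, r <= r' by exact: nbhs_pinfty_ge (num_real r).
by apply: filterS large => r' rr' x /Dr /le_trans; exact.
Qed.

Lemma bounded_closure (D : set 'rV[R]_d) :
  bounded_set D -> bounded_set (closure D).
Proof.
move=> /bounded_setP[r Dr]; apply/bounded_setP; exists r => x Dx.
have cB : closed (closed_ball_ Num.Def.normr (0 : 'rV[R]_d) r).
  exact: closed_closed_ball_.
have DB : D `<=` closed_ball_ Num.Def.normr (0 : 'rV[R]_d) r.
  by move=> z /Dr; rewrite /closed_ball_ /= sub0r normrN.
have := cB _ (closureS DB Dx).
by rewrite /closed_ball_ /= sub0r normrN.
Qed.

Lemma compact_boundary (D : set 'rV[R]_d) :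
  open D -> bounded_set D -> compact (boundary D).
Proof.
move=> oD bD; apply: bounded_closed_compact.
  have /bounded_setP[r Dr] := bounded_closure bD.
  by apply/bounded_setP; exists r => x [/Dr].
rewrite /boundary setDE; apply: closedI; first exact: closed_closure.
by apply: open_closedC; exact: open_interior.
Qed.

(** Boundedness matters: [diam] is a real supremum, which is meaningless for an
    unbounded set. *)
Lemma le_diam (D : set 'rV[R]_d) x y :
  bounded_set D -> D x -> D y -> enorm (x - y) <= diam D.
Proof.
move=> /bounded_setP[r Dr] Dx Dy; apply: ub_le_sup; last by exists (x, y).
exists (Num.sqrt ((r + r) ^+ 2 *+ d)) => _ [[z w] [/= Dz Dw] <-].
apply: (le_trans (le_enorm_norm _)); rewrite ler_wsqrtr// lerMn2r.
apply/orP; right; rewrite lerXn2r ?nnegrE//.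
- by rewrite addr_ge0// (le_trans _ (Dr _ Dz)).
- by rewrite (le_trans (ler_normB _ _))// lerD//; exact: Dr.
Qed.

Lemma node_dense (M : mesh R d) (Om : set 'rV[R]_d) y :
  mesh_of M Om -> bounded_set Om -> closure Om y ->
  exists l : 'I_(nnode M), `|y - node l| <= mesh_size M.
Proof.
move=> hM bOm; have [aff _ cover _] := hM.
rewrite {1}cover => -[K KM Ky].
have /card_gt0P[l lK] : (0 < #|K|)%N by have [-> _] := aff _ KM.
exists l; apply: (le_trans (le_norm_enorm _)).
have bK : bounded_set (simplex K).
  have /bounded_setP[r Omr] := bounded_closure bOm.
  apply/bounded_setP; exists r => z Kz; apply: Omr.
  by rewrite cover; exists K.
have Kl : simplex K (node l) by eexists; exact: bary_vertex.
apply: (le_trans (le_diam bK Ky Kl)).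
exact: (le_bigmax_cond 0 (fun K => diam (simplex K)) KM).
Qed.

End euclidean_theory.

(** * Boundary values of the numerical solution *)

Lemma inf_sup_cst (R : realType) (A B : Type) (F : B -> A -> \bar R) c :
  [set: A] !=set0 -> [set: B] !=set0 -> (forall be al, F be al = c) ->
  ereal_inf [set ereal_sup [set F be al | al in [set: A]] | be in [set: B]] = c.
Proof.
move=> [al0 _] [be0 _] Fc.
have sup_c be : ereal_sup [set F be al | al in [set: A]] = c.
  rewrite -[RHS]ereal_sup1; congr ereal_sup; apply/seteqP; split => /=.
  - by move=> _ [al _ <-]; rewrite /= Fc.
  - by move=> _ ->; exists al0; rewrite ?Fc.
rewrite -[RHS]ereal_inf1; congr ereal_inf; apply/seteqP; split => /=.
- by move=> _ [be _ <-]; rewrite /= sup_c.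
- by move=> _ ->; exists be0; rewrite ?sup_c.
Qed.

Section scheme_theory.
Context {R : realType} {d : nat} {Om : set 'rV[R]_d} {T : R}.
Context {A B : metricType R} {vT g : 'rV[R]_d -> R}.
Context {M : nat -> mesh R d} {N : nat -> nat} {h : nat -> R} {K : nat -> nat}.
Context {P : forall i, ('rV[R]_d -> R) -> 'rV[R]_(nnode (M i))}.
Context {ex im : forall i, coefs A B (M i)}.
Context {fi : nat -> A -> B -> 'rV[R]_d -> R}.
Context {v : forall i, nat -> 'rV[R]_(nnode (M i))}.
Context (hdiscr : discretisation Om T M N h K).

Lemma time_step_itv i k : (k <= K i)%N -> k%:R * h i \in `[0, T].
Proof.
move=> kK; rewrite in_itv /= -(ds_final hdiscr i).
have hi := ds_step_gt0 hdiscr i.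
by apply/andP; split; [apply: mulr_ge0 => //; exact: ltW|rewrite ler_pM2r// ler_nat].
Qed.

(** At a boundary node the operators reduce to [v - P_i g], which is zero at time
    step [k] by the boundary condition, whatever the controls; the scheme then
    says that the discrete time derivative is zero. *)
Lemma boundary_node_stationary i k (l : 'I_(nnode (M i))) :
  open Om -> [set: A] !=set0 -> [set: B] !=set0 ->
  numerical_solution Om vT g N h K P ex im fi v ->
  (k < K i)%N -> ~~ (l < N i)%N -> v i k.+1 ord0 l = v i k ord0 l.
Proof.
move=> oOm A0 B0 hsol kK lN.
have hM := ds_mesh hdiscr i.
have res be al : (opE Om (N i) (ex i) al be (fe (v i k.+1)) l +
    opI Om (N i) (im i) al be (fe (v i k)) l -
    opF Om (N i) (fi i) (P i g) al be l)%:E = 0%E.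
  congr EFin; rewrite /opE /opI /opF (negPf lN) add0r.
  rewrite (ns_boundary hsol kK); first by rewrite (fe_node hM) subrr.
  exact: noninterior_node_boundary (ds_nodes hdiscr i) lN.
have := ns_scheme hsol kK l; rewrite (inf_sup_cst A0 B0 res).
rewrite adde0 => -[] /eqP.
rewrite oppr_eq0 mulf_eq0 invr_eq0 (gt_eqF (ds_step_gt0 hdiscr i)) orbF.
by rewrite subr_eq0 => /eqP.
Qed.

(** For [k = K i] the boundary condition is not imposed; it is inherited from the
    previous step through the boundary nodes. *)
Lemma solution_boundary i k z :
  open Om -> 0 < T -> [set: A] !=set0 -> [set: B] !=set0 ->
  numerical_solution Om vT g N h K P ex im fi v ->
  (k <= K i)%N -> boundary Om z -> fe (v i k) z = fe (P i g) z.
Proof.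
move=> oOm T0 A0 B0 hsol; rewrite leq_eqVlt => /orP[/eqP kK|kK] bz; last first.
  exact: (ns_boundary hsol kK).
have K0 : (0 < K i)%N.
  rewrite lt0n; apply: contraTneq T0 => K0.
  by rewrite -(ds_final hdiscr i) K0 mul0r ltxx.
case: k kK => [kK|k kK]; first by rewrite -kK in K0.
have kK' : (k < K i)%N by rewrite -kK.
rewrite -(ns_boundary hsol kK' bz); apply/eqP; rewrite -subr_eq0 -feB; apply/eqP.
apply: (fe_boundary0 (ds_mesh hdiscr i) oOm (ds_nodes hdiscr i)) => // l lN.
by rewrite !mxE (boundary_node_stationary oOm A0 B0 hsol kK' lN) subrr.
Qed.

(** Without an approaching sequence the envelopes would be an empty supremum and
    an empty infimum. *)
Lemma exists_approaching t y :
  bounded_set Om -> 0 <= t <= T -> closure Om y ->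
  exists k (l : forall i, 'I_(nnode (M i))), approaching h K t y k l.
Proof.
move=> bOm /andP[t0 tT] yOm.
have [l yl] : exists l : forall i, 'I_(nnode (M i)),
    forall i, `|y - node (l i)| <= mesh_size (M i).
  exists (fun i => sval (cid (node_dense (ds_mesh hdiscr i) bOm yOm))) => i.
  by case: cid.
have th i : 0 <= t / h i by rewrite divr_ge0// ltW// (ds_step_gt0 hdiscr).
have h0 i := ds_step_gt0 hdiscr i.
exists (fun i => Num.truncn (t / h i)), l; split.
- move=> i; rewrite -ltnS truncn_lt_nat// ltr_pdivrMr//.
  apply: (le_lt_trans tT); rewrite -(ds_final hdiscr i) ltr_pM2r// ltr_nat.
  by [].
- have th0 : t - h i @[i --> \oo] --> t.
    by rewrite -[X in _ --> X]subr0; apply: cvgB; [exact: cvg_cst|exact: ds_step hdiscr].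
  apply: (squeeze_cvgr _ th0 (cvg_cst t)); near=> i.
  have /andP[lo hi] := truncn_itv (th i).
  rewrite -ler_pdivlMr// lo andbT lerBlDr.
  rewrite ltr_pdivrMr// -natr1 mulrDl mul1r in hi.
  exact: ltW.
- apply/cvgrPdist_le => e e0; near=> i.
  apply: (le_trans (yl i)); near: i.
  by apply: (cvgr_le _ (ds_mesh_size hdiscr)).
Unshelve. all: by end_near. Qed.

End scheme_theory.

(** * The envelopes at the barrier points *)

Theorem lemma8p1 (R : realType) (d : nat) (Om : set 'rV[R]_d) (T : R)
    (A B : metricType R) (a c f : A -> B -> 'rV[R]_d -> R)
    (b : A -> B -> 'rV[R]_d -> 'rV[R]_d) (vT g : 'rV[R]_d -> R)
    (M : nat -> mesh R d) (N : nat -> nat) (h : nat -> R) (K : nat -> nat)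
    (P : forall i, ('rV[R]_d -> R) -> 'rV[R]_(nnode (M i)))
    (ex im : forall i, coefs A B (M i)) (fi : nat -> A -> B -> 'rV[R]_d -> R)
    (v : forall i, nat -> 'rV[R]_(nnode (M i)))
    (omega : set 'rV[R]_d) (zeta xi : 'rV[R]_d -> R -> R -> 'rV[R]_d -> R)
    (hdata : problem_data Om T a c f b vT g)
    (hdiscr : discretisation Om T M N h K)
    (hproj : projections Om N P)
    (hsplit : splitting Om a c f b N ex im fi)
    (hmono : monotone_scheme Om N h ex im)
    (hsol : numerical_solution Om vT g N h K P ex im fi v)
    (homega : omega `<=` boundary Om)
    (hbarrier : barrier Om omega T g h K P v zeta xi)
    (hconv_g : projections_converge Om h K P (fun _ => g))
    (hconv_zeta : forall y (e : R), omega y -> 0 < e ->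
       projections_converge Om h K P (zeta y e))
    (hconv_xi : forall y (e : R), omega y -> 0 < e ->
       projections_converge Om h K P (xi y e)) :
  forall (t : R) x, 0 <= t <= T -> omega x ->
    upper_envelope h K v t x = (g x)%:E /\ lower_envelope h K v t x = (g x)%:E.
Proof.
move=> t y tT oy.
have [_ oOm _ bOm _] := pd_domain hdata.
have [A0 B0] := pd_nonempty hdata.
have T0 := pd_T hdata.
have bdcl : boundary Om `<=` closure Om by move=> z [].
have cbd := compact_boundary oOm bOm.
have ycl := bdcl _ (homega _ oy).
have tI : t \in `[0, T] by rewrite in_itv.
have main k l : approaching h K t y k l ->
    v i (k i) ord0 (l i) @[i --> \oo] --> g y.
  move=> [kK st ly].
  have sI i : (k i)%:R * h i \in `[0, T] := time_step_itv hdiscr (kK i).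
  have lcl i : closure Om (node (l i)) .
    by apply: node_closure; exact: ds_mesh hdiscr i.
  have bdv i z : boundary Om z -> fe (v i (k i)) z = fe (P i g) z.
    exact: (solution_boundary hdiscr oOm T0 A0 B0 hsol (kK i)).
  have vnode i : v i (k i) ord0 (l i) = fe (v i (k i)) (node (l i)).
    by rewrite (fe_node (ds_mesh hdiscr i)).
  have lower dl : 0 < dl ->
      \forall i \near \oo, g y - dl <= fe (v i (k i)) (node (l i)).
    have [q [qmin qy [L L0 qL]]] := br_1b hbarrier oy tT.
    apply: (barrier_bound (phi := zeta y) (q := q) (G := fun i => fe (P i g))
      (Phi := fun e i => fe (P i (zeta y e ((k i)%:R * h i))))
      cbd bdcl _ sI lcl tI ycl st ly _ _ qy L0 qL bdv).
    - exact: (pd_g_cont hdata).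
    - by move=> e e0; have [] := br_zeta hbarrier oy e0.
    - by move=> e e0; have [] := qmin e e0.
    - by move=> e e0; apply: filterS (hconv_g e e0) => i Pconv z zD; exact: Pconv.
    - move=> e e' e0 e'0.
      by apply: filterS (hconv_zeta y e oy e0 e' e'0) => i Pconv z zD; exact: Pconv.
    - move=> e e0; have [i0 minbd] := br_1a hbarrier oy e0.
      by near=> i; apply: minbd => //; near: i; exact: nbhs_infty_ge.
  have upper dl : 0 < dl ->
      \forall i \near \oo, - g y - dl <= - fe (v i (k i)) (node (l i)).
    have [q [qmax qy [L L0 qL]]] := br_2b hbarrier oy tT.
    have NL0 : 0 <= - L by rewrite oppr_ge0.
    have NqL : - xi y e t y - - xi y e t (q e) @[e --> 0^'+] --> - L.
      by under eq_fun do rewrite -opprD; exact: cvgN.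
    apply: (barrier_bound (g := fun z => - g z)
      (phi := fun e s z => - xi y e s z) (q := q)
      (V := fun i z => - fe (v i (k i)) z) (G := fun i z => - fe (P i g) z)
      (Phi := fun e i z => - fe (P i (xi y e ((k i)%:R * h i))) z)
      cbd bdcl _ sI lcl tI ycl st ly _ _ qy NL0 NqL).
    - have /(_ y) gy : continuous g by exact: (pd_g_cont hdata).
      exact: (cvgN gy).
    - move=> e e0; have [xic _] := br_xi hbarrier oy e0.
      by move=> p; exact: (cvgN (xic p)).
    - move=> e e0 z bz; have [_ /(_ z bz)] := qmax e e0.
      lra.
    - by move=> i z bz; rewrite (bdv _ _ bz).
    - move=> e e0; apply: filterS (hconv_g e e0) => i Pconv z zD.
      by rewrite -opprD normrN; exact: Pconv.
    - move=> e e' e0 e'0.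
      apply: filterS (hconv_xi y e oy e0 e' e'0) => i Pconv z zD.
      by rewrite -opprD normrN; exact: Pconv.
    - move=> e e0; have [i0 maxbd] := br_2a hbarrier oy e0.
      near=> i.
      have [||z bz zmax] := maxbd i (k i) => //.
        by near: i; exact: nbhs_infty_ge.
      by exists z => // w /zmax; lra.
  apply/cvgrPdist_le => e e0; near=> i.
  have lo : g y - e <= fe (v i (k i)) (node (l i)) by near: i; exact: lower.
  have up : - g y - e <= - fe (v i (k i)) (node (l i)) by near: i; exact: upper.
  by rewrite vnode ler_norml; apply/andP; split; lra.
have [k [l kl]] := exists_approaching hdiscr bOm tT ycl.
have limE k' l' : approaching h K t y k' l' ->
    (limn_einf (fun i => (v i (k' i) ord0 (l' i))%:E) = (g y)%:E) *
    (limn_esup (fun i => (v i (k' i) ord0 (l' i))%:E) = (g y)%:E).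
  by move=> /main vg; apply: cvg_limn_einf_sup; apply: cvg_EFin => //; near=> i.
split.
- rewrite /upper_envelope -[RHS]ereal_sup1; congr ereal_sup.
  apply/seteqP; split => [_ [k' [l' [/limE kl' ->]]]|_ ->] /=; first exact: kl'.2.
  by exists k, l; split => //; rewrite (limE _ _ kl).2.
- rewrite /lower_envelope -[RHS]ereal_inf1; congr ereal_inf.
  apply/seteqP; split => [_ [k' [l' [/limE kl' ->]]]|_ ->] /=; first exact: kl'.1.
  by exists k, l; split => //; rewrite (limE _ _ kl).1.
Unshelve. all: by end_near. Qed.
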